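(* Let $D=(X,\mathcal{B})$ be a symmetric $2$-$(v,k,\lambda)$ design, let $B_0\in\mathcal{B}$ and let $D_1=\mathrm{Res}(X,\mathcal{B},B_0)$. Then $\gamma(D_1)\geq \gamma(D)-1$.
   Context: Let $v,k,\lambda$ be positive integers with $v\geq k\geq 2$. A $2$-$(v,k,\lambda)$ design $D=(X,\mathcal{B})$ consists of a set $X$ of $v$ points and a family $\mathcal{B}$ of $k$-subsets of $X$ (blocks) such that every pair of distinct points is contained in exactly $\lambda$ blocks; $D$ is symmetric if $|\mathcal{B}|=v$. For a symmetric design and $B_0\in\mathcal{B}$, the residual design is $\mathrm{Res}(X,\mathcal{B},B_0)=(X\setminus B_0,\{B\setminus B_0: B\in\mathcal{B}, B\neq B_0\})$. For such an incidence structure, the incidence graph is the bipartite graph on points and blocks with $x$ adjacent to $B$ iff $x\in B$; a dominating set of a graph is a set $S$ of vertices such that every vertex not in $S$ is adjacent to some vertex of $S$; $\gamma(\cdot)$ is the minimum size of a dominating set of the incidence graph. *)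

(* Defs.v *)
From HB Require Import structures.
From mathcomp Require Import all_boot.

Set Implicit Arguments.
Unset Strict Implicit.
Unset Printing Implicit Defensive.

(* The blocks form an indexed family, so that repeated blocks are allowed.     *)
(* This matters for residuals: distinct blocks B, B' of a symmetric design may *)
(* satisfy B :\: B0 = B' :\: B0 (e.g. the residual of the complement of the    *)
(* Fano plane is a 2-(3,2,2) design, in which every block occurs twice).       *)
Record incidence_structure := IncidenceStructure {
  point : finType;
  block_index : finType;
  block : block_index -> {set point} }.

Definition is_2design (v k lambda : nat) (D : incidence_structure) : Prop :=
  [/\ #|point D| = v,
      forall b : block_index D, #|block b| = k
    & forall x y : point D, x != y ->
        #|[set b : block_index D | (x \in block b) && (y \in block b)]|
          = lambda].

Definition symmetric_2design (v k lambda : nat) (D : incidence_structure) :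
    Prop :=
  is_2design v k lambda D /\ #|block_index D| = v.

(* The set B :\: B0, seen as a set of elements of the subtype ~: B0, is the    *)
(* preimage of B under val.                                                    *)
Definition residual (D : incidence_structure) (b0 : block_index D) :
    incidence_structure :=
  @IncidenceStructure
    {x : point D | x \in ~: block b0}
    {b : block_index D | b != b0}
    (fun b => [set x | val x \in block (val b)]).

Definition incidence_rel (D : incidence_structure) :
    rel (point D + block_index D) :=
  fun u w => match u, w with
  | inl x, inr b => x \in block b
  | inr b, inl x => x \in block b
  | _, _ => false
  end.

Definition dominating (V : finType) (e : rel V) (S : {set V}) : bool :=
  [forall u, (u \notin S) ==> [exists w, (w \in S) && e u w]].

(* The default value [set: V] of the arg min is always dominating.             *)
Definition domination_number (V : finType) (e : rel V) : nat :=
  #|[arg min_(S < [set: V] | dominating e S) #|S| ]|.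

Definition gamma (D : incidence_structure) : nat :=
  domination_number (@incidence_rel D).

(* Main.v *)
(** Adding the vertex [b0] to a dominating set of the residual gives a
    dominating set of [D]: [b0] dominates itself and the deleted points, which
    are exactly the points on [b0]. *)
Require Import Defs.
From HB Require Import structures.
From mathcomp Require Import all_boot.

Set Implicit Arguments.
Unset Strict Implicit.
Unset Printing Implicit Defensive.

(** The incidence graph of the residual is that of [D] with the closed neighbourhood of the vertex
    [b0] deleted. A minimum dominating set of the residual, carried back to [D], dominates all
    surviving vertices; the one extra vertex [b0] handles the deleted ones ([dominating_residual]),
    and counting gives [gamma_residual]. *)

Lemma dominatingP (V : finType) (e : rel V) (S : {set V}) :
  reflect (forall u, u \notin S -> exists2 w, w \in S & e u w)
          (dominating e S).
Proof.
apply: (iffP 'forall_implyP) => domS u /domS; first exact: exists_inP.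
by move=> ?; apply/exists_inP.
Qed.

Lemma dominating_setT (V : finType) (e : rel V) : dominating e [set: V].
Proof. by apply/dominatingP => u; rewrite inE. Qed.

Lemma domination_number_min (V : finType) (e : rel V) (S : {set V}) :
  dominating e S -> domination_number e <= #|S|.
Proof.
rewrite /domination_number; case: arg_minnP => [|T _ minT]; last exact: minT.
exact: dominating_setT.
Qed.

Lemma domination_number_witness (V : finType) (e : rel V) :
  exists2 S : {set V}, dominating e S & #|S| = domination_number e.
Proof.
rewrite /domination_number; case: arg_minnP => [|T domT _]; last by exists T.
exact: dominating_setT.
Qed.

Section Residual.

Variables (D : incidence_structure) (b0 : block_index D).

Definition residual_emb (u : point (residual b0) + block_index (residual b0)) :
    point D + block_index D :=
  match u with inl x => inl (val x) | inr b => inr (val b) end.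

(** Blocks lose only deleted points, so the residual graph is an induced subgraph of that of [D]. *)
Lemma incidence_rel_residual u w :
  incidence_rel (residual_emb u) (residual_emb w) = incidence_rel u w.
Proof. by case: u w => [x|b] [y|c] //=; rewrite inE. Qed.

(** Points off [b0] and indices other than [b0] are exactly the elements of the two subtypes, so
    only the closed neighbourhood of [b0] is lost. *)
Lemma residual_embP (u : point D + block_index D) :
  [\/ u = inr b0, incidence_rel u (inr b0) | exists u', u = residual_emb u'].
Proof.
case: u => [x|b].
  case: (boolP (x \in block b0)) => [xb0|]; first exact: Or32.
  rewrite -in_setC => xNb0; apply: Or33.
  by exists (inl (Sub x xNb0 : point (residual b0))).
have [->|bNb0] := eqVneq b b0; first exact: Or31.
by apply: Or33; exists (inr (Sub b bNb0 : block_index (residual b0))).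
Qed.

Lemma dominating_residual S :
  dominating (@incidence_rel (residual b0)) S ->
  dominating (@incidence_rel D) (inr b0 |: residual_emb @: S).
Proof.
move=> /dominatingP domS; apply/dominatingP => u.
case: (residual_embP u) => [->|ub0|[u' ->]]; first by rewrite setU11.
  by exists (inr b0); rewrite ?setU11.
rewrite in_setU1 negb_or => /andP[_ u'NS].
(* A surviving vertex outside the enlarged set keeps the dominator it has in the residual. *)
have /domS[w wS u'w] : u' \notin S by apply: contra u'NS; exact: imset_f.
exists (residual_emb w); first by rewrite in_setU1 imset_f ?orbT.
by rewrite incidence_rel_residual.
Qed.

Lemma gamma_residual : gamma D <= (gamma (residual b0)).+1.
Proof.
rewrite /gamma; have [S domS <-] := domination_number_witness (@incidence_rel (residual b0)).
apply: leq_trans (domination_number_min (dominating_residual domS)) _.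
(* [b0] adds at most one element, and an image is no larger than its source. *)
by rewrite cardsU1 -add1n leq_add ?leq_b1 ?leq_imset_card.
Qed.

End Residual.

Theorem theorem5p2 (v k lambda : nat)
    (hlambda : 0 < lambda) (hk : 2 <= k) (hkv : k <= v)
    (D : incidence_structure) (hD : symmetric_2design v k lambda D)
    (b0 : block_index D) :
  gamma (residual b0) >= gamma D - 1.
Proof. by rewrite leq_subLR add1n gamma_residual. Qed.
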